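(* Let $\xi\in\mathbb{Z}\setminus\{0\}$ and let $\frac{a}{b}\in\mathbb{Q}$ be given (with $a,b\in\mathbb{Z}$, $b\ne 0$). Then there exist infinitely many primes $p$ such that $F_p(\xi)\neq\frac{a}{b}$.
   Context: For a prime $p$, $|\cdot|_p$ is the $p$-adic absolute value normalized by $|p|_p=p^{-1}$, and $\mathbb{Q}_p$ is the completion of $\mathbb{Q}$ with respect to it. For $z\in\mathbb{Q}_p$ with $|z|_p\le 1$ the series $F_p(z):=\sum_{n=0}^\infty n!\,z^n$ (Euler's factorial series) converges in $\mathbb{Q}_p$, and $F_p(z)\in\mathbb{Q}_p$ denotes its sum. *)

(* Defs.v *)
From HB Require Import structures.
From mathcomp Require Import all_boot all_order all_algebra generic_quotient.
From mathcomp Require Import ring_quotient zify ring lra.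
From mathcomp Require Import all_classical topology sequences.

Set Implicit Arguments.
Unset Strict Implicit.
Unset Printing Implicit Defensive.

Import Order.TTheory GRing.Theory Num.Theory.

Local Open Scope classical_set_scope.
Local Open Scope ring_scope.
Local Open Scope quotient_scope.

(* For prime p, logn p (absz (numq x)) - logn p (absz (denq x)) is the p-adic
   valuation of x.  For p not prime, logn p is identically 0 and padic_abs p is
   the trivial absolute value; hence primality of p is not needed below to
   build the completion. *)
Definition padic_abs (p : nat) (x : rat) : rat :=
  if x == 0 then 0
  else p%:R ^ ((logn p `|denq x|)%:Z - (logn p `|numq x|)%:Z).

Lemma logn_nonprime p n : ~~ prime p -> logn p n = 0%N.
Proof. by rewrite lognE => /negbTE->. Qed.

Lemma padic_abs_frac p (n d : int) : n != 0 -> d != 0 ->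
  padic_abs p (n%:~R / d%:~R) = p%:R ^ ((logn p `|d|)%:Z - (logn p `|n|)%:Z).
Proof.
move=> n0 d0; set x := _ / _.
have dR0 : d%:~R != 0 :> rat by rewrite intr_eq0.
have x0 : x != 0 by rewrite mulf_neq0 ?invr_eq0 ?intr_eq0.
have E : numq x * d = n * denq x.
  apply/eqP; rewrite -(eqr_int rat) !rmorphM /= numqE /x.
  by rewrite mulrAC divfK.
have nx0 : numq x != 0 by rewrite numq_eq0.
have := congr1 (logn p) (congr1 absz E).
rewrite !abszM !lognM ?absz_gt0 ?denq_neq0 // /padic_abs (negbTE x0) => EE.
congr (_ ^ _); lia.
Qed.

Lemma padic_abs0 p : padic_abs p 0 = 0.
Proof. by rewrite /padic_abs eqxx. Qed.

Lemma padic_abs1 p : padic_abs p 1 = 1.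
Proof. by rewrite /padic_abs oner_eq0 /= logn1. Qed.

Lemma padic_abs_gt0 p x : x != 0 -> 0 < padic_abs p x.
Proof.
move=> x0; rewrite /padic_abs (negbTE x0).
have [pp|np] := boolP (prime p); last by rewrite !logn_nonprime.
by apply: exprz_gt0; rewrite ltr0n prime_gt0.
Qed.

Lemma padic_abs_eq0 p x : (padic_abs p x == 0) = (x == 0).
Proof.
have [->|/padic_abs_gt0] := eqVneq x 0; first by rewrite padic_abs0 eqxx.
by move=> /(_ p)/gt_eqF.
Qed.

Lemma padic_abs_ge0 p x : 0 <= padic_abs p x.
Proof.
have [->|/padic_abs_gt0] := eqVneq x 0; first by rewrite padic_abs0.
by move=> /(_ p)/ltW.
Qed.

Lemma padic_absM p : {morph padic_abs p : x y / x * y}.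
Proof.
move=> x y; have [->|x0] := eqVneq x 0; first by rewrite mul0r padic_abs0 mul0r.
have [->|y0] := eqVneq y 0; first by rewrite mulr0 padic_abs0 mulr0.
rewrite -{1}[x]divq_num_den -{1}[y]divq_num_den mulf_div -!intrM.
rewrite padic_abs_frac ?mulf_neq0 ?numq_eq0 ?denq_neq0 //.
rewrite /padic_abs (negbTE x0) (negbTE y0).
rewrite !abszM !lognM ?absz_gt0 ?denq_neq0 ?numq_eq0 //.
have [pp|np] := boolP (prime p); last by rewrite !logn_nonprime // mulr1.
rewrite -expfzDr ?pnatr_eq0 -?lt0n ?prime_gt0 //; congr (_ ^ _); lia.
Qed.

Lemma padic_absN p x : padic_abs p (- x) = padic_abs p x.
Proof.
by rewrite /padic_abs oppr_eq0 numqN denqN abszN.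
Qed.

Lemma padic_absV p x : padic_abs p x^-1 = (padic_abs p x)^-1.
Proof.
have [->|x0] := eqVneq x 0; first by rewrite !(invr0, padic_abs0).
have px0 : padic_abs p x != 0 by rewrite padic_abs_eq0.
by apply: (mulfI px0); rewrite -padic_absM !mulfV // padic_abs1.
Qed.

Lemma padic_absD p x y :
  padic_abs p (x + y) <= Num.max (padic_abs p x) (padic_abs p y).
Proof.
have [->|x0] := eqVneq x 0.
  by rewrite add0r padic_abs0 le_max lexx orbT.
have [->|y0] := eqVneq y 0; first by rewrite addr0 le_max lexx.
have [->|xy0] := eqVneq (x + y) 0.
  by rewrite padic_abs0 le_max padic_abs_ge0.
have dx0 := denq_neq0 x; have dy0 := denq_neq0 y.
pose d := denq x * denq y; have d0 : d != 0 by rewrite mulf_neq0.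
have [a ax] : exists a : int, x = a%:~R / d%:~R.
  exists (numq x * denq y); rewrite /d !intrM -[LHS]divq_num_den.
  by rewrite -mulf_div divff ?mulr1 // intr_eq0.
have [b bx] : exists b : int, y = b%:~R / d%:~R.
  exists (denq x * numq y); rewrite /d !intrM -[LHS]divq_num_den.
  by rewrite -mulf_div divff ?mul1r // intr_eq0.
have xyE : x + y = (a + b)%:~R / d%:~R by rewrite ax bx intrD mulrDl.
have nz (c : int) (z : rat) : z != 0 -> z = c%:~R / d%:~R -> c != 0.
  by move=> + zE; rewrite zE; apply: contra => /eqP->; rewrite mul0r.
have a0 := nz _ _ x0 ax; have b0 := nz _ _ y0 bx; have ab0 := nz _ _ xy0 xyE.
rewrite xyE ax bx !padic_abs_frac //.
have [pp|np] := boolP (prime p); last by rewrite !logn_nonprime // le_max lexx.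
have p1 : 1 <= p%:R :> rat by rewrite ler1n prime_gt0.
have : (minn (logn p `|a|%N) (logn p `|b|%N) <= logn p `|(a + b)%R|%N)%N.
  have dv (c : int) k : c != 0 ->
      ((p ^ k)%N%:Z %| c)%Z = (k <= logn p `|c|%N)%N.
    by move=> c0; rewrite dvdzE /= pfactor_dvdn ?absz_gt0.
  by rewrite -dv // rpredD // dv // (geq_minl, geq_minr).
rewrite geq_min le_max => /orP[h|h]; apply/orP; [left|right];
  by apply: ler_weXz2l => //; lia.
Qed.

Lemma padic_absB p x y :
  padic_abs p (x - y) <= Num.max (padic_abs p x) (padic_abs p y).
Proof. by rewrite -(padic_absN p y) padic_absD. Qed.

Lemma padic_abs_isosceles p x y :
  padic_abs p (x - y) < padic_abs p y -> padic_abs p x = padic_abs p y.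
Proof.
move=> h; apply/eqP; rewrite eq_le; apply/andP; split.
  have := padic_absD p (x - y) y; rewrite subrK.
  by move/le_trans; apply; rewrite ge_max lexx ltW.
have := padic_absB p x (x - y); rewrite opprB addrC subrK le_max.
by rewrite [X in _ || X]leNgt h orbF.
Qed.

Definition padic_cauchy (p : nat) : {pred nat -> rat} := fun u =>
  `[< forall e : rat, 0 < e -> exists N : nat, forall m n : nat,
      (N <= m)%N -> (N <= n)%N -> padic_abs p (u m - u n) < e >].

Lemma padic_cauchy_bounded p u : u \in padic_cauchy p ->
  exists2 C : rat, 0 < C & \forall n \near \oo, padic_abs p (u n) <= C.
Proof.
move=> /asboolP/(_ 1 ltr01)[N hN].
exists (Num.max 1 (padic_abs p (u N))); first by rewrite lt_max ltr01.
exists N => // n /= Nn; have := padic_absD p (u n - u N) (u N).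
rewrite subrK => /le_trans; apply; rewrite ge_max !le_max lexx orbT andbT.
by rewrite ltW // hN.
Qed.

Lemma padic_cauchy_subring p : GRing.subring_closed (padic_cauchy p).
Proof.
split.
- apply/asboolP => e e0; exists 0%N => m n _ _.
  by rewrite subrr padic_abs0.
- move=> u v /asboolP cu /asboolP cv; apply/asboolP => e e0.
  have [N1 h1] := cu _ e0; have [N2 h2] := cv _ e0.
  exists (maxn N1 N2) => m n; rewrite !geq_max => /andP[m1 m2] /andP[n1 n2].
  have -> : (u - v) m - (u - v) n = (u m - u n) - (v m - v n).
    by rewrite /= !fctE; ring.
  by apply: le_lt_trans (padic_absB _ _ _) _; rewrite gt_max h1 ?h2.
- move=> u v cu cv; apply/asboolP => e e0.
  have [C1 C10 [M1 _ b1]] := padic_cauchy_bounded cu.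
  have [C2 C20 [M2 _ b2]] := padic_cauchy_bounded cv.
  move: cu cv => /asboolP cu /asboolP cv.
  have [N1 h1] := cu _ (divr_gt0 e0 C20); have [N2 h2] := cv _ (divr_gt0 e0 C10).
  exists (maxn (maxn M1 M2) (maxn N1 N2)) => m n.
  rewrite !geq_max => /andP[/andP[? ?] /andP[? ?]] /andP[/andP[? ?] /andP[? ?]].
  have -> : (u * v) m - (u * v) n = (u m - u n) * v m + u n * (v m - v n).
    by rewrite /= !fctE; ring.
  apply: le_lt_trans (padic_absD _ _ _) _; rewrite gt_max !padic_absM.
  apply/andP; split.
    apply: le_lt_trans (_ : padic_abs p (u m - u n) * C2 < _).
      by rewrite ler_wpM2l ?padic_abs_ge0 // b2.
    by rewrite -ltr_pdivlMr // h1.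
  apply: le_lt_trans (_ : C1 * padic_abs p (v m - v n) < _).
    by rewrite ler_wpM2r ?padic_abs_ge0 // b1.
  by rewrite mulrC -ltr_pdivlMr // h2.
Qed.

HB.instance Definition _ p :=
  GRing.isSubringClosed.Build (nat -> rat) (padic_cauchy p)
    (padic_cauchy_subring p).

Record cauchy_seq (p : nat) :=
  CauchySeq { cauchy_val :> nat -> rat; _ : cauchy_val \in padic_cauchy p }.

HB.instance Definition _ p := [isSub for @cauchy_val p].
HB.instance Definition _ p := [Choice of cauchy_seq p by <:].
HB.instance Definition _ p :=
  [SubChoice_isSubComNzRing of cauchy_seq p by <:].

Definition null_seq (p : nat) : {pred cauchy_seq p} := fun u =>
  `[< forall e : rat, 0 < e ->
      exists N : nat, forall n : nat, (N <= n)%N -> padic_abs p (u n) < e >].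

Lemma null_seq_ideal p : idealr_closed (@null_seq p).
Proof.
split.
- apply/asboolP => e e0; exists 0%N => n _.
  by rewrite (_ : _ n = 0) ?padic_abs0.
- apply/negP => /asboolP/(_ _ ltr01)[N /(_ N (leqnn _))].
  by rewrite (_ : _ N = 1) ?padic_abs1.
- move=> a u v /asboolP nu /asboolP nv; apply/asboolP => e e0.
  have [C C0 [M _ b]] := padic_cauchy_bounded (valP a).
  have [N1 h1] := nu _ (divr_gt0 e0 C0); have [N2 h2] := nv _ e0.
  exists (maxn M (maxn N1 N2)) => n; rewrite !geq_max => /and3P[? ? ?].
  have -> : (a * u + v) n = a n * u n + v n by [].
  apply: le_lt_trans (padic_absD _ _ _) _; rewrite gt_max padic_absM h2 // andbT.
  apply: le_lt_trans (_ : C * padic_abs p (u n) < _).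
    by rewrite ler_wpM2r ?padic_abs_ge0 // b.
  by rewrite mulrC -ltr_pdivlMr // h1.
Qed.

HB.instance Definition _ p :=
  isIdealr.Build (cauchy_seq p) (@null_seq p) (null_seq_ideal p).

(* Completion of rat for padic_abs p: Cauchy sequences modulo null sequences. *)
Definition padic (p : nat) := {ideal_quot @null_seq p}.

HB.instance Definition _ p := GRing.ComNzRing.on (padic p).
HB.instance Definition _ p := EqQuotient.on (padic p).
HB.instance Definition _ p := NzRingQuotient.on (padic p).

Lemma padic_pi_eq0 p (u : cauchy_seq p) :
  (\pi_(padic p) u == 0) = (u \in @null_seq p).
Proof.
have -> : 0 = \pi_(padic p) 0 by rewrite raddf0.
by rewrite -Quotient.idealrBE subr0.
Qed.

Lemma padic_reprB p (u : cauchy_seq p) :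
  repr (\pi_(padic p) u) - u \in @null_seq p.
Proof. by rewrite Quotient.idealrBE reprK. Qed.

Lemma non_null_seq p (u : cauchy_seq p) : u \notin @null_seq p ->
  exists2 c, 0 < c & \forall n \near \oo, padic_abs p (u n) = c.
Proof.
move/negP => nu; have [e [e0 hu]] : exists e : rat, 0 < e /\
    forall N, exists2 n, (N <= n)%N & e <= padic_abs p (u n).
  apply: contrapT => h; apply: nu; apply/asboolP => e e0.
  apply: contrapT => h2; apply: h; exists e; split => // N.
  apply: contrapT => h3; apply: h2; exists N => n Nn.
  by rewrite ltNge; apply/negP => en; apply: h3; exists n.
have /asboolP/(_ _ e0)[N hN] := valP u.
have [n0 Nn0 en0] := hu N.
exists (padic_abs p (u n0)); first exact: lt_le_trans en0.
exists N => // n /= Nn; apply: padic_abs_isosceles.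
exact: lt_le_trans (hN _ _ Nn Nn0) en0.
Qed.


Fact padic_mulVf_ex p (x : padic p) : x != 0 -> exists y, y * x = 1.
Proof.
rewrite -[x]reprK; set u := repr x; rewrite padic_pi_eq0 => nu.
have [c c0 [N _ hN]] := non_null_seq nu.
have un0 n : (N <= n)%N -> u n != 0.
  by move=> /hN h; rewrite -(padic_abs_eq0 p) h gt_eqF.
have cv : (fun n => (u n)^-1) \in padic_cauchy p.
  apply/asboolP => e e0; have /asboolP/(_ (e * (c * c))) := valP u.
  rewrite !mulr_gt0 // => /(_ isT)[M hM]; exists (maxn N M) => m n.
  rewrite !geq_max => /andP[Nm Mm] /andP[Nn Mn].
  have -> : (u m)^-1 - (u n)^-1 = (u n - u m) / (u m * u n).
    by field; rewrite !un0.
  rewrite padic_absM padic_absV padic_absM !hN // ltr_pdivrMr ?mulr_gt0 //.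
  exact: hM.
exists (\pi_(padic p) (CauchySeq cv)); rewrite -rmorphM -(rmorph1 \pi_(padic p)) /=.
apply/eqP; rewrite -Quotient.idealrBE; apply/asboolP => e e0; exists N => n Nn.
by rewrite (_ : _ n = (u n)^-1 * u n - 1) // mulVf ?un0 // subrr padic_abs0.
Qed.

(* No y satisfies y * 0 = 1, so the default value gives padic_inv 0 = 0. *)
Definition padic_inv p (x : padic p) : padic p :=
  xget 0 [set y : padic p | y * x = 1].

Fact padic_mulVf p (x : padic p) : x != 0 -> padic_inv x * x = 1.
Proof. by move=> /padic_mulVf_ex[y yx]; by rewrite /padic_inv; case: xgetP => [z _ ->|/(_ y)]. Qed.

Fact padic_invr0 p : padic_inv 0 = 0 :> padic p.
Proof.
apply: xgetPN => y /= /eqP.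
by rewrite mulr0 eq_sym oner_eq0.
Qed.

HB.instance Definition _ p :=
  GRing.ComNzRing_isField.Build (padic p) (@padic_mulVf p) (@padic_invr0 p).

Fact cauchy_cst p (q : rat) : (fun=> q) \in padic_cauchy p.
Proof. by apply/asboolP => e e0; exists 0%N => *; rewrite subrr padic_abs0. Qed.

Definition padic_of_rat p (q : rat) : padic p :=
  \pi_(padic p) (CauchySeq (cauchy_cst p q)).

Fact padic_of_rat_zmod p : zmod_morphism (@padic_of_rat p).
Proof.
move=> x y; rewrite /padic_of_rat -rmorphB /=; congr (\pi_(padic p) _).
exact: val_inj.
Qed.

Fact padic_of_rat_monoid p : monoid_morphism (@padic_of_rat p).
Proof.
split=> [|x y]; first rewrite /padic_of_rat -(rmorph1 \pi_(padic p)) /=.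
  congr (\pi_(padic p) _); exact: val_inj.
rewrite /padic_of_rat -rmorphM /=; congr (\pi_(padic p) _).
exact: val_inj.
Qed.

HB.instance Definition _ p :=
  GRing.isZmodMorphism.Build rat (padic p) (@padic_of_rat p)
    (@padic_of_rat_zmod p).
HB.instance Definition _ p :=
  GRing.isMonoidMorphism.Build rat (padic p) (@padic_of_rat p)
    (@padic_of_rat_monoid p).

(* Extension of padic_abs p to the completion.  The limit is taken in rat: it
   exists since the absolute values along a Cauchy sequence that is not null are
   eventually constant (padic_norm_near). *)
Definition padic_norm p (x : padic p) : rat :=
  limn (fun n => padic_abs p (repr x n) : rat^o).

Lemma padic_norm0 p : padic_norm (0 : padic p) = 0.
Proof.
apply: (@cvg_lim rat^o (@metric_hausdorff rat rat^o)).
apply/(@metricType_numDomainType.cvgrPdist_lt rat rat^o) => e e0.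
have : repr (0 : padic p) \in @null_seq p by rewrite -padic_pi_eq0 reprK.
move=> /asboolP/(_ _ e0)[N hN]; exists N => // n /= Nn.
by rewrite /mdist/= subr0 ger0_norm ?padic_abs_ge0 ?hN.
Qed.

Lemma padic_norm_near p (u : cauchy_seq p) : \pi_(padic p) u != 0 ->
  \forall n \near \oo, padic_abs p (u n) = padic_norm (\pi_(padic p) u).
Proof.
rewrite -[X in X != 0]reprK padic_pi_eq0; set v := repr _ => nv.
have [c c0 [N1 _ h1]] := non_null_seq nv.
have -> : padic_norm (\pi_(padic p) u) = c.
  apply: (@cvg_lim rat^o (@metric_hausdorff rat rat^o)).
  by apply: cvg_near_cst; exists N1.
have /asboolP/(_ _ c0)[N2 h2] := padic_reprB u.
exists (maxn N1 N2) => // n /=; rewrite geq_max => /andP[n1 n2].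
rewrite -(h1 n n1); apply: padic_abs_isosceles; rewrite h1 //.
rewrite -padic_absN opprB; exact: h2.
Qed.

Lemma padic_norm_lt p (u : cauchy_seq p) (e : rat) : 0 < e ->
  (\forall n \near \oo, padic_abs p (u n) < e) ->
  padic_norm (\pi_(padic p) u) < e.
Proof.
have [->|u0] := eqVneq (\pi_(padic p) u) 0; first by rewrite padic_norm0.
move=> e0 h; near \oo => n.
rewrite -(_ : padic_abs p (u n) = padic_norm (\pi_(padic p) u)).
  by near: n.
by near: n; exact: padic_norm_near.
Unshelve. all: by end_near. Qed.

Lemma padic_norm_ge0 p (x : padic p) : 0 <= padic_norm x.
Proof.
have [->|] := eqVneq x 0; first by rewrite padic_norm0.
rewrite -[x]reprK => x0; near \oo => n.
rewrite -(_ : padic_abs p (repr x n) = padic_norm (\pi_(padic p) (repr x))).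
  exact: padic_abs_ge0.
by near: n; exact: padic_norm_near.
Unshelve. all: by end_near. Qed.

Lemma padic_norm_eq0 p (x : padic p) : (padic_norm x == 0) = (x == 0).
Proof.
have [->|x0] := eqVneq x 0; first by rewrite padic_norm0 eqxx.
apply/negbTE; apply: contra x0 => /eqP nx0; rewrite -[x]reprK.
apply: contraT => x0; have := x0; rewrite padic_pi_eq0 => /negP[].
have [N _ hN] := padic_norm_near x0.
apply/asboolP => e e0; exists N => n Nn.
by rewrite hN // reprK nx0.
Qed.

Lemma padic_normM p : {morph @padic_norm p : x y / x * y}.
Proof.
move=> x y; have [->|] := eqVneq x 0; first by rewrite mul0r padic_norm0 mul0r.
have [->|] := eqVneq y 0; first by rewrite mulr0 padic_norm0 mulr0.
rewrite -[x]reprK -[y]reprK; set u := repr x; set v := repr y => v0 u0.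
have uv0 := mulf_neq0 u0 v0; rewrite -rmorphM /= in uv0 *.
near \oo => n.
rewrite -(near (padic_norm_near u0) n) // -(near (padic_norm_near v0) n) //.
by rewrite -(near (padic_norm_near uv0) n) // -padic_absM.
Unshelve. all: by end_near. Qed.

Lemma padic_normD p (x y : padic p) :
  padic_norm (x + y) <= Num.max (padic_norm x) (padic_norm y).
Proof.
have [->|] := eqVneq x 0; first by rewrite add0r le_max lexx orbT.
have [->|] := eqVneq y 0; first by rewrite addr0 le_max lexx.
have [->|] := eqVneq (x + y) 0; first by rewrite padic_norm0 le_max padic_norm_ge0.
rewrite -[x]reprK -[y]reprK -raddfD /=; set u := repr x; set v := repr y.
move=> uv0 v0 u0; near \oo => n.
rewrite -(near (padic_norm_near u0) n) // -(near (padic_norm_near v0) n) //.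
by rewrite -(near (padic_norm_near uv0) n) // padic_absD.
Unshelve. all: by end_near. Qed.

Lemma padic_norm_rat p (q : rat) :
  padic_norm (padic_of_rat p q) = padic_abs p q.
Proof.
have [->|q0] := eqVneq q 0; first by rewrite rmorph0 padic_norm0 padic_abs0.
have x0 : padic_of_rat p q != 0 by rewrite fmorph_eq0.
by near \oo => n; rewrite -(near (padic_norm_near x0) n).
Unshelve. all: by end_near. Qed.

Lemma padic_normN p (x : padic p) : padic_norm (- x) = padic_norm x.
Proof.
have h : padic_norm (-1 : padic p) = 1.
  by rewrite -(rmorphN1 (padic_of_rat p)) padic_norm_rat padic_absN padic_abs1.
by rewrite -mulN1r padic_normM h mul1r.
Qed.

Definition padic_dist p (x y : padic p) : rat := padic_norm (x - y).

Fact padic_distxx p (x : padic p) : padic_dist x x = 0.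
Proof. by rewrite /padic_dist subrr padic_norm0. Qed.

Fact padic_dist_eq0 p (x y : padic p) : padic_dist x y = 0 -> x = y.
Proof. by move/eqP; rewrite padic_norm_eq0 subr_eq0 => /eqP. Qed.

Fact padic_dist_sym p (x y : padic p) : padic_dist x y = padic_dist y x.
Proof. by rewrite /padic_dist -padic_normN opprB. Qed.

Lemma padic_dist_max p (y x z : padic p) :
  padic_dist x z <= Num.max (padic_dist x y) (padic_dist y z).
Proof. by rewrite /padic_dist -(subrKA y) padic_normD. Qed.

Fact padic_dist_triangle p (y x z : padic p) :
  padic_dist x z <= padic_dist x y + padic_dist y z.
Proof.
apply: le_trans (padic_dist_max y x z) _.
by rewrite ge_max lerDl lerDr !padic_norm_ge0.
Qed.

HB.instance Definition _ p := @isMetric.Build rat (padic p) (@padic_dist p)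
  (@padic_distxx p) (@padic_dist_eq0 p) (@padic_dist_sym p)
  (@padic_dist_triangle p).
HB.instance Definition _ p := isPointed.Build (padic p) 0.

Lemma ball_padicE p (x y : padic p) (e : rat) :
  ball x e y = (padic_norm (x - y) < e) :> Prop.
Proof. by rewrite ballEmdist. Qed.

Lemma padic_cauchy_approx p (u : cauchy_seq p) (e : rat) : 0 < e ->
  \forall n \near \oo, padic_norm (\pi_(padic p) u - padic_of_rat p (u n)) < e.
Proof.
move=> e0; have /asboolP/(_ _ e0)[N hN] := valP u.
exists N => // n /= Nn; rewrite /padic_of_rat -raddfB /=.
by apply: padic_norm_lt => //; exists N => // m /= Nm; exact: hN.
Qed.

Lemma padic_of_rat_dense p : dense (range (padic_of_rat p)).
Proof.
move=> O [x Ox] openO; have /nbhs_ballP[e /= e0 eO] : nbhs x O.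
  by apply: open_nbhs_nbhs.
rewrite -[x]reprK in eO.
have [N _ /(_ N (leqnn N)) hN] := padic_cauchy_approx (repr x) e0.
exists (padic_of_rat p (repr x N)); split; last by exists (repr x N).
by apply: eO; rewrite ball_padicE.
Qed.

Fact padic_complete p (F : set_system (padic p)) :
  ProperFilter F -> cauchy F -> cvg F.
Proof.
move=> FF cF.
have ex (n : nat) : exists q : rat, F (ball (padic_of_rat p q) n.+1%:R^-1).
  have e0 : 0 < n.+1%:R^-1 :> rat by rewrite invr_gt0 ltr0n.
  have /cauchyP/(_ _ e0)[x Fx] := cF.
  have := padic_cauchy_approx (repr x) e0.
  rewrite reprK => -[N _ /(_ N (leqnn N)) hN].
  exists (repr x N); apply: filterS Fx => y; rewrite !ball_padicE => xy.
  apply: le_lt_trans (padic_dist_max x _ _) _.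
  by rewrite gt_max padic_dist_sym /padic_dist hN.
have [q Fq] := choice ex.
have small (e : rat) : 0 < e -> exists N : nat, N.+1%:R^-1 <= e.
  move=> e0; exists (Num.truncn e^-1).
  rewrite -[leRHS]invrK lef_pV2 ?posrE ?invr_gt0 ?ltr0n //.
  by rewrite ltW // truncnS_gt.
have le1 (N n : nat) : (N <= n)%N -> n.+1%:R^-1 <= N.+1%:R^-1 :> rat.
  by move=> Nn; rewrite lef_pV2 ?posrE ?ltr0n // ler_nat.
have cq : q \in padic_cauchy p.
  apply/asboolP => e e0; have [N hN] := small _ e0.
  exists N => m n Nm Nn; rewrite -padic_norm_rat rmorphB /=.
  have [z [zm zn]] := filter_ex (filterI (Fq m) (Fq n)).
  rewrite !ball_padicE in zm zn.
  apply: le_lt_trans (padic_dist_max z _ _) _; rewrite gt_max.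
  rewrite [padic_dist z _]padic_dist_sym.
  apply/andP; split; apply: lt_le_trans hN; first exact: lt_le_trans (le1 _ _ Nm).
  exact: lt_le_trans (le1 _ _ Nn).
apply/cvg_ex; exists (\pi_(padic p) (CauchySeq cq)).
apply/fcvg_ballP => e e0; have [N hN] := small _ e0.
have [M _ hM] := padic_cauchy_approx (CauchySeq cq) e0.
pose n := maxn N M; apply: filterS (Fq n) => y; rewrite !ball_padicE => qy.
apply: le_lt_trans (padic_dist_max (padic_of_rat p (q n)) _ _) _.
rewrite gt_max {1}/padic_dist (hM n) /= ?leq_maxr //=.
apply: lt_le_trans qy (le_trans _ hN); exact/le1/leq_maxl.
Qed.

HB.instance Definition _ p := Uniform_isComplete.Build (padic p)
  (@padic_complete p).

(* The sum is meaningful where the series converges, in particular for p prime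
   and padic_norm z <= 1 (cvg_euler_series); elsewhere limn is a default value. *)
Definition euler_series (p : nat) (z : padic p) : padic p :=
  limn (series (fun n => n`!%:R * z ^+ n)).

Lemma padic_norm_fact_small p (e : rat) : prime p -> 0 < e ->
  \forall n \near \oo, padic_norm (n`!%:R : padic p) < e.
Proof.
move=> pp e0; pose k := (Num.truncn e^-1).+1; exists (p ^ k)%N => // n /= kn.
have pk0 : (0 < p ^ k)%N by rewrite expn_gt0 prime_gt0.
have pk1 : (k <= logn p n`!)%N.
  by rewrite -pfactor_dvdn ?fact_gt0 // dvdn_fact // pk0.
rewrite -(rmorph_nat (padic_of_rat p)) padic_norm_rat.
have -> : n`!%:R = (n`!%:Z)%:~R / (1%:Z)%:~R :> rat by rewrite divr1.
rewrite padic_abs_frac ?eqz_nat -?lt0n ?fact_gt0 // absz1 logn1 absz_nat.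
have p1 : 1 <= p%:R :> rat by rewrite ler1n prime_gt0.
apply: (@le_lt_trans _ _ (p%:R ^ (- k%:Z))); first by
  apply: ler_weXz2l; rewrite ?add0r ?lerN2 ?lez_nat.
rewrite -exprnN -[ltRHS]invrK ltf_pV2 ?posrE ?invr_gt0 ?exprn_gt0 ?ltr0n
  ?prime_gt0 //.
apply: lt_le_trans (truncnS_gt _) _.
by rewrite -natrX ler_nat ltnW // ltn_expl // prime_gt1.
Qed.

Lemma cvg_euler_series p (z : padic p) : prime p -> padic_norm z <= 1 ->
  cvgn (series (fun n => n`!%:R * z ^+ n)).
Proof.
move=> pp z1; apply: cauchy_cvg; apply: cauchy_exP => e e0.
have [N _ hN] := padic_norm_fact_small pp e0.
have term n : (N <= n)%N -> padic_norm (n`!%:R * z ^+ n) < e.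
  move=> Nn; rewrite padic_normM; apply: le_lt_trans (hN n Nn).
  rewrite ler_piMr ?padic_norm_ge0 //.
  elim: n {Nn} => [|n IH].
    by rewrite expr0 -(rmorph1 (padic_of_rat p)) padic_norm_rat padic_abs1.
  by rewrite exprS padic_normM mulr_ile1 ?padic_norm_ge0.
exists (series (fun n => n`!%:R * z ^+ n) N); exists N => // n /= Nn.
rewrite ball_padicE -padic_normN opprB -(subnKC Nn).
elim: (n - N)%N => [|k IH]; first by rewrite addn0 subrr padic_norm0.
rewrite addnS /series /= big_nat_recr //= addrAC.
apply: le_lt_trans (padic_normD _ _) _.
by rewrite gt_max IH term // leq_addr.
Qed.

Lemma euler_seriesP p (z l : padic p) :
  series (fun n => n`!%:R * z ^+ n) @ \oo --> l -> euler_series z = l.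
Proof. exact: (@cvg_lim (padic p) (@metric_hausdorff rat (padic p))). Qed.

Lemma padic_norm_int p (m : int) : padic_norm (m%:~R : padic p) <= 1.
Proof.
rewrite -(rmorph_int (padic_of_rat p)) padic_norm_rat.
have [->|m0] := eqVneq m 0; first by rewrite padic_abs0.
have -> : m%:~R = m%:~R / (1%:Z)%:~R :> rat by rewrite divr1.
rewrite padic_abs_frac // absz1 logn1.
have [pp|np] := boolP (prime p); last by rewrite !logn_nonprime.
rewrite -[leRHS](expr0z p%:R); apply: ler_weXz2l; last by lia.
by rewrite ler1n prime_gt0.
Qed.

(* Main.v *)
Require Import Defs.
From mathcomp Require Import all_boot all_order all_algebra.
From mathcomp Require Import all_classical.
From mathcomp Require Import topology sequences zify ring lra.

(* The Pade approximants Q_n F - P_n of F(z) = sum_m m! z^m come from Laguerre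
   polynomials and have remainder n!^2 z^(2n) sum_i C(n+i,n)^2 i! z^i.  If
   F_p(xi) = a/b for every prime p outside a finite set, the integer
   N_n = a Q_n(xi) - b P_n(xi) is therefore divisible by the part of n!^2 prime
   to that set, which is at least n!^2 / c^n.  But |N_n| <= c'^n n!, and two
   consecutive N_n cannot both vanish: a contradiction for large n.  To avoid
   infinite series, F is truncated at degree L and the remainder formula is
   proved modulo L!. *)

Import Order.TTheory GRing.Theory Num.Theory.

Local Open Scope classical_set_scope.
Local Open Scope ring_scope.

(** * Growth of factorials and of their prime parts *)

Lemma logn_fact_leq p n : prime p -> (logn p n`! <= n)%N.
Proof.
move=> pp; rewrite logn_fact //.
(* The extra summand carries the induction on [m]: as [p >= 2], twice the next quotient is at most
   the current one. *)
suff H m : (\sum_(1 <= k < m.+1) n %/ p ^ k + n %/ p ^ m <= n)%N.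
  exact: leq_trans (leq_addr _ _) (H n).
elim: m => [|m IH]; first by rewrite big_geq // expn0 divn1.
apply: leq_trans IH; rewrite big_nat_recr //= -addnA leq_add2l addnn -muln2.
rewrite expnSr divnMA; apply: leq_trans (leq_mul (leqnn _) (prime_gt1 pp)) _.
exact: leq_divM.
Qed.

Lemma part_fact_leq B n :
  ((n`!)`_[pred p | (p < B)%N] <= B`! ^ n)%N.
Proof.
apply: dvdn_leq; first by rewrite expn_gt0 fact_gt0.
apply/dvdn_partP; first exact: part_gt0.
move=> p; rewrite pi_of_part ?fact_gt0 // => /andP[/= pn pB].
have pp : prime p by move: pn; rewrite mem_primes => /andP[].
rewrite p_part; apply: (@dvdn_trans (p ^ n)).
  apply: dvdn_exp2l; apply: (@leq_trans (logn p n`!)); last exact: logn_fact_leq.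
  by apply: dvdn_leq_log; rewrite ?fact_gt0 ?dvdn_part.
by apply: dvdn_exp2r; rewrite dvdn_fact // prime_gt0 // ltnW.
Qed.

Lemma expn_leq m n e : (m <= n)%N -> (m ^ e <= n ^ e)%N.
Proof. by case: e => // e mn; rewrite leq_exp2r. Qed.

Lemma expn_ltn_fact C K : exists n0, forall n, (n0 <= n)%N -> (K * C ^ n < n`!)%N.
Proof.
(* Since [D = 2 * C.+1], the power [D ^ n] has a factor [2 ^ n > n] to absorb the constant
   [K * D ^ D]. *)
pose D := (2 * C).+2; exists (K * D ^ D)%N => n nK.
have D0 : (0 < D ^ D)%N by rewrite expn_gt0.
have h m : (D ^ m <= m`! * D ^ D)%N.
  elim: m => [|m IH]; first by rewrite fact0 mul1n.
  have [mD|Dm] := ltnP m D.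
    apply: leq_trans (leq_pexp2l _ mD) _ => //.
    by rewrite leq_pmull // fact_gt0.
  rewrite factS expnS -mulnA; apply: leq_mul => //; exact: leqW.
rewrite -(ltn_pmul2r D0); apply: leq_trans (h n).
apply: (@leq_trans (2 ^ n * C.+1 ^ n)); last first.
  by rewrite -expnMn expn_leq // /D; lia.
rewrite mulnAC; apply: (@leq_ltn_trans (n * C.+1 ^ n)).
  by apply: leq_mul => //; apply: expn_leq.
by rewrite ltn_pmul2r ?expn_gt0 // ltn_expl.
Qed.

(** * Linear forms and their remainders modulo [L!] *)

(* The number a Q_n(z) - b P_n(z), defined through the three-term recurrence of
   the monic Laguerre polynomials. *)
Fixpoint euler_form (z a b : int) (n : nat) : int :=
  match n with
  | 0 => a
  | m.+1 =>
    if m is k.+1 then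
      (1 - (2 * k + 3)%:R * z) * euler_form z a b m
        - (k.+1 ^ 2)%:R * z ^+ 2 * euler_form z a b k
    else a * (1 - z) - b
  end.

Lemma euler_formSS z a b n : euler_form z a b n.+2 =
  (1 - (2 * n + 3)%:R * z) * euler_form z a b n.+1
    - (n.+1 ^ 2)%:R * z ^+ 2 * euler_form z a b n.
Proof. by []. Qed.

Definition tail_sum (z : int) (k L : nat) : int :=
  \sum_(i < L) ('C(k + i, k) ^ 2 * i`!)%:R * z ^+ i.

(* The case k = -1 of tail_sum_rec, with tail_sum z (-1) L read as 1. *)
Lemma tail_sum_rec0 z L :
  z ^+ 2 * tail_sum z 1 L - (1 - z) * tail_sum z 0 L + 1 =
  L`!%:R * z ^+ L * (1 + L%:R * z).
Proof.
elim: L => [|L IH]; first by rewrite /tail_sum !big_ord0 fact0; ring.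
rewrite /tail_sum !big_ord_recr /= -!/(tail_sum _ _ _) bin0 bin1 factS.
set u := tail_sum z 1 L in IH *; set v := tail_sum z 0 L in IH *.
rewrite !(natrM, natrX, natrD).
transitivity (z ^+ 2 * u - (1 - z) * v + 1 +
  L`!%:R * z ^+ L * (z ^+ 2 * (1 + L%:R) ^+ 2 - (1 - z))); first by ring.
rewrite IH [z ^+ L.+1]exprS -[L.+1%:R]natr1 expr1n; ring.
Qed.

(** Multiplied by [(k+1)!^2 z^(2k+2)], the left side is the recurrence of [euler_form] applied to
    the remainders [k!^2 z^(2k) tail_sum z k L]. Truncation leaves only a boundary term divisible by
    [L!]. *)
Lemma tail_sum_rec z k L :
  (k.+2 ^ 2)%:R * z ^+ 2 * tail_sum z k.+2 L
    - (1 - (2 * k + 3)%:R * z) * tail_sum z k.+1 L + tail_sum z k L =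
  L`!%:R * z ^+ L *
    (('C(k.+1 + L, k.+1) ^ 2)%:R - ('C(k + L, k) ^ 2)%:R
       + L%:R * ('C(k.+1 + L, k.+1) ^ 2)%:R * z).
Proof.
elim: L => [|L IH].
  by rewrite /tail_sum !big_ord0 !addn0 !binn fact0; ring.
rewrite /tail_sum !big_ord_recr /= -!/(tail_sum _ _ _) factS.
set u := tail_sum z k.+2 L in IH *; set v := tail_sum z k.+1 L in IH *.
set t := tail_sum z k L in IH *.
have e1 : (k.+2 * 'C(k.+2 + L, k.+2) = L.+1 * 'C(k.+1 + L.+1, k.+1))%N.
  have -> : (k.+2 + L = (k.+1 + L).+1)%N by [].
  rewrite -mul_bin_diag addnS.
  have := mul_bin_left (k.+1 + L).+1 k.+1.
  have -> : ((k.+1 + L).+1 - k.+1 = L.+1)%N by lia.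
  by rewrite mul_bin_diag => <-.
have e2 : ('C(k.+1 + L.+1, k.+1) = 'C(k + L.+1, k) + 'C(k.+1 + L, k.+1))%N.
  by rewrite addSn binS addnC addnS.
have e3 : (L.+1 * ('C(k.+1 + L.+1, k.+1) + 'C(k + L.+1, k)) =
   (L + 2 * k + 3) * 'C(k.+1 + L, k.+1))%N.
  rewrite e2.
  have h : (k.+1 * 'C(k.+1 + L, k.+1) = L.+1 * 'C(k + L.+1, k))%N.
    rewrite addnS addSn mul_bin_left; congr (_ * _)%N; lia.
  nia.
move: IH e1 e2 e3.
set x := 'C(k.+1 + L, k.+1); set y := 'C(k + L, k); set w := 'C(k.+2 + L, k.+2).
set x' := 'C(k.+1 + L.+1, k.+1); set y' := 'C(k + L.+1, k) => IH e1 e2 e3.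
have {}e1 : (k.+2)%:R * w%:R = (L.+1)%:R * x'%:R :> int by rewrite -!natrM e1.
have {}e2 : x'%:R = y'%:R + x%:R :> int by rewrite e2 natrD.
have {}e3 : (L.+1)%:R * (x'%:R + y'%:R) = (L + 2 * k + 3)%:R * x%:R :> int.
  by rewrite -natrD -!natrM e3.
(* The old [e3] times Pascal's rule [x = x' - y']: this puts the boundary terms for [L] and [L.+1]
   in comparable form. *)
have {}e3 : (L.+1)%:R * (x'%:R ^+ 2 - y'%:R ^+ 2) = (L + 2 * k + 3)%:R * x%:R ^+ 2 :> int.
  rewrite expr2 mulrA -e3; have -> : x%:R = x'%:R - y'%:R :> int by rewrite e2; ring.
  ring.
have {e2} e1 : (k.+2)%:R ^+ 2 * w%:R ^+ 2 = (L.+1)%:R ^+ 2 * x'%:R ^+ 2 :> int.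
  by rewrite -!exprMn e1.
rewrite [z ^+ L.+1]exprS !(natrM, natrX) in IH *.
transitivity (((k.+2%:R) ^+ 2 * z ^+ 2 * u - (1 - (2 * k + 3)%:R * z) * v + t) +
  L`!%:R * z ^+ L * ((k.+2)%:R ^+ 2 * w%:R ^+ 2 * z ^+ 2
    - (1 - (2 * k + 3)%:R * z) * x%:R ^+ 2 + y%:R ^+ 2)); first by ring.
rewrite IH e1.
transitivity (L`!%:R * (z * z ^+ L) * (L.+1%:R * (x'%:R ^+ 2 - y'%:R ^+ 2)
  + L.+1%:R ^+ 2 * x'%:R ^+ 2 * z)); last by ring.
rewrite e3 !natrD; ring.
Qed.

(** Modulo [m] both terms obey the same recurrence, the boundary terms being multiples of [L!]. They
    agree at 0 and 1 because [b] times the truncated series is congruent to [a]. *)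
Lemma euler_form_congr (z a b m : int) (n L : nat) :
  (m %| L`!%:R)%Z ->
  (m %| b * (\sum_(i < L) i`!%:R * z ^+ i) - a)%Z ->
  (m %| euler_form z a b n - b * (n`! ^ 2)%:R * z ^+ (2 * n) * tail_sum z n L)%Z.
Proof.
move=> mL ma.
have T0 : tail_sum z 0 L = \sum_(i < L) i`!%:R * z ^+ i.
  by apply: eq_bigr => i _; rewrite bin0 exp1n mul1n.
suff [//] : (m %| euler_form z a b n
              - b * (n`! ^ 2)%:R * z ^+ (2 * n) * tail_sum z n L)%Z /\
  (m %| euler_form z a b n.+1
              - b * (n.+1`! ^ 2)%:R * z ^+ (2 * n.+1) * tail_sum z n.+1 L)%Z.
elim: n => [|n [IH1 IH2]]; last split => //.
  split.
    by rewrite -rpredN; congr (_ %| _)%Z: ma; rewrite T0 fact0 muln0 expr0 /=; ring.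
  have -> : euler_form z a b 1 - b * (1`! ^ 2)%:R * z ^+ (2 * 1) * tail_sum z 1 L
    = - (1 - z) * (b * tail_sum z 0 L - a) - b * (L`!%:R * z ^+ L * (1 + L%:R * z)).
    rewrite -tail_sum_rec0 (_ : (1`! ^ 2)%:R = 1) // muln1 /=; ring.
  by rewrite T0 rpredB // -?mulrA dvdz_mull // dvdz_mulr.
rewrite euler_formSS.
have := tail_sum_rec z n L.
set E := (_ - _ + _ * z) => hE.
set d1 := (_ - _ : int) in IH1; set d2 := (_ - _ : int) in IH2.
have -> : (1 - (2 * n + 3)%:R * z) * euler_form z a b n.+1
    - (n.+1 ^ 2)%:R * z ^+ 2 * euler_form z a b n
    - b * ((n.+2)`! ^ 2)%:R * z ^+ (2 * n.+2) * tail_sum z n.+2 L =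
  (1 - (2 * n + 3)%:R * z) * d2 - (n.+1 ^ 2)%:R * z ^+ 2 * d1
   - (b * (n.+1`! ^ 2)%:R * z ^+ (2 * n.+1) * z ^+ L * E) * L`!%:R.
  have -> : (b * (n.+1`! ^ 2)%:R * z ^+ (2 * n.+1) * z ^+ L * E) * L`!%:R
    = (b * (n.+1`! ^ 2)%:R * z ^+ (2 * n.+1)) * (L`!%:R * z ^+ L * E) by ring.
  rewrite -hE /d1 /d2 !mulnS !factS !natrX !natrM !exprD; ring.
by rewrite !rpredB // dvdz_mull.
Qed.

(** * Size and non-vanishing of the forms *)

Lemma euler_form_bound (z a b : int) n : z != 0 ->
  `|euler_form z a b n| <= (`|a| + `|b|) * n`!%:R * (3 * `|z|) ^+ n.
Proof.
move=> z0; have z1 : 1 <= `|z| by lia.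
set K := `|a| + `|b|; set C := 3 * `|z|.
have K0 : 0 <= K by rewrite addr_ge0.
have C0 : 0 <= C by rewrite mulr_ge0.
suff [//] : `|euler_form z a b n| <= K * n`!%:R * C ^+ n /\
  `|euler_form z a b n.+1| <= K * n.+1`!%:R * C ^+ n.+1.
elim: n => [|n [IH1 IH2]].
  split; first by rewrite fact0 expr0 !mulr1 /= lerDl.
  rewrite (_ : 1`! = 1%N) // !mulr1 expr1 /=; apply: le_trans (ler_normB _ _) _.
  rewrite normrM; apply: (@le_trans _ _ (`|a| * (1 + `|z|) + `|b|)).
    by rewrite lerD2r ler_wpM2l // (le_trans (ler_normB _ _)) ?normr1.
  rewrite /K /C; nia.
split=> //; rewrite euler_formSS; apply: le_trans (ler_normB _ _) _.
rewrite ![`|_ * euler_form _ _ _ _|]normrM [`|_ * z ^+ 2|]normrM normrX normr_nat.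
have h : `|1 - (2 * n + 3)%:R * z| <= (2 * n + 4)%:R * `|z|.
  apply: le_trans (ler_normB _ _) _; rewrite normr1 normrM normr_nat.
  rewrite !natrD; lra.
apply: (@le_trans _ _ ((2 * n + 4)%:R * `|z| * (K * n.+1`!%:R * C ^+ n.+1)
  + (n.+1 ^ 2)%:R * `|z| ^+ 2 * (K * n`!%:R * C ^+ n))).
  apply: lerD; first exact: ler_pM.
  by rewrite ler_wpM2l // mulr_ge0 ?exprn_ge0.
rewrite -subr_ge0.
(* The constant 3 in [C] leaves a nonnegative slack: [9(n+2) - 3(2n+4) - (n+1) = 2n+5]. *)
have -> : K * n.+2`!%:R * C ^+ n.+2 - ((2 * n + 4)%:R * `|z| * (K * n.+1`!%:R * C ^+ n.+1)
  + (n.+1 ^ 2)%:R * `|z| ^+ 2 * (K * n`!%:R * C ^+ n)) =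
  K * n.+1`!%:R * C ^+ n * `|z| ^+ 2 * (2 * n + 5)%:R.
  rewrite [n.+2`!]factS ![n.+1`!]factS !(exprS C).
  move: (C ^+ n) (n`!) => X f; rewrite /C !(natrM, natrD, natrX) -!natr1; ring.
by rewrite !mulr_ge0 ?exprn_ge0.
Qed.

(** The coefficient of the oldest term is nonzero, so two consecutive zeros would descend to [a = 0]
    and [a(1-z) - b = 0], forcing [b = 0]. *)
Lemma euler_form_neq0 (z a b : int) n : z != 0 -> b != 0 ->
  (euler_form z a b n != 0) || (euler_form z a b n.+1 != 0).
Proof.
move=> z0 b0; rewrite -negb_and; elim: n => [|n].
  apply/negP => /andP[/eqP /= -> /eqP]; rewrite mul0r sub0r => /eqP.
  by rewrite oppr_eq0 (negPf b0).
apply: contra => /andP[/eqP e1]; rewrite euler_formSS e1 mulr0 sub0r oppr_eq0.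
have nz : (n.+1 ^ 2)%:R * z ^+ 2 != 0.
  by rewrite mulf_neq0 ?expf_neq0 // pnatr_eq0 expn_eq0.
by rewrite mulf_eq0 (negPf nz) /= => ->; rewrite eqxx.
Qed.

(** * From p-adic values to divisibility, and the conclusion *)

Lemma euler_series_rat_dvd p (xi a b : int) K : prime p -> b != 0 ->
  euler_series (xi%:~R : padic p) = padic_of_rat p (a%:~R / b%:~R) ->
  \forall L \near \oo,
    ((p ^ K)%N %| b * (\sum_(i < L) i`!%:R * xi ^+ i) - a)%Z.
Proof.
move=> pp b0 E; have cv := cvg_euler_series pp (padic_norm_int p xi).
have p1 : 1 < p%:R :> rat by rewrite ltr1n prime_gt1.
pose e : rat := p%:R ^ (- (K + logn p `|b|)%:Z).
have e0 : 0 < e by rewrite exprz_gt0 // (lt_trans ltr01).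
have {cv} /cvg_ballP/(_ e e0) : series (fun n => n`!%:R * (xi%:~R : padic p) ^+ n) @ \oo
   --> padic_of_rat p (a%:~R / b%:~R) by rewrite -E.
apply: filterS => L; rewrite ball_padicE.
set S := \sum_(i < L) _.
have -> : series (fun n => n`!%:R * (xi%:~R : padic p) ^+ n) L =
    padic_of_rat p S%:~R.
  rewrite rmorph_int /series /= big_mkord raddf_sum /=; apply: eq_bigr => i _.
  by rewrite rmorphM rmorphXn /= rmorph_nat.
rewrite -rmorphB /= padic_norm_rat => h.
have [->|nz] := eqVneq (b * S - a) 0; first exact: dvdz0.
(* Over the denominator [b], p-adic closeness of the partial sum to [a/b] becomes a lower bound on
   the valuation of the integer [b * S - a]. *)
have E2 : a%:~R / b%:~R - S%:~R = (- (b * S - a))%:~R / b%:~R :> rat.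
  rewrite opprB.
  rewrite rmorphB rmorphM /= mulrBl mulrAC divff ?mul1r // intr_eq0 //.
rewrite dvdzE /= pfactor_dvdn ?absz_gt0 //.
move: h; rewrite E2 padic_abs_frac ?oppr_eq0 // abszN /e ltr_eXz2l //; lia.
Qed.

Lemma part_fact_dvd_euler_form (pi : nat_pred) (xi a b : int) n : b != 0 ->
  (forall p, prime p -> p \in pi ->
     euler_series (xi%:~R : padic p) = padic_of_rat p (a%:~R / b%:~R)) ->
  ((n`! ^ 2)`_pi %| `|euler_form xi a b n|)%N.
Proof.
move=> b0 E; have n0 : (0 < n`! ^ 2)%N by rewrite expn_gt0 fact_gt0.
apply/dvdn_partP; first exact: part_gt0.
move=> p; rewrite pi_of_part // => /andP[/= pn ppi].
have pp : prime p by move: pn; rewrite mem_primes => /andP[].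
rewrite partn_part; last by move=> q; rewrite inE => /eqP->.
set m := ((n`! ^ 2)`_p)%N; have m0 : (0 < m)%N by exact: part_gt0.
have [L0 _ hL] := euler_series_rat_dvd p xi a b (logn p (n`! ^ 2)) pp b0 (E p pp ppi).
(* [L >= m] gives [m %| L!], and [L >= L0] makes the truncated series match [a/b] modulo [m]. *)
pose L := maxn L0 m.
have mL : (m%:Z %| L`!%:R)%Z.
  by rewrite dvdzE natz absz_nat dvdn_fact // m0 leq_maxr.
have := hL L (leq_maxl _ _); rewrite -p_part -/m => mF.
have := euler_form_congr xi a b m n L mL mF.
rewrite rpredBr ?dvdzE // -dvdzE -!mulrA dvdz_mull // dvdz_mulr //.
by rewrite dvdzE natz absz_nat dvdn_part.
Qed.

Theorem corollary2 (xi a b : int) (hxi : xi != 0) (hb : b != 0) :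
  infinite_set [set p : nat | prime p /\
    euler_series (xi%:~R : padic p) <> padic_of_rat p (a%:~R / b%:~R)].
Proof.
move=> /finite_seqP[s hs]; pose B := (\max_(q <- s) q).+1.
have E p : prime p -> (B <= p)%N ->
    euler_series (xi%:~R : padic p) = padic_of_rat p (a%:~R / b%:~R).
  move=> pp Bp; apply: contrapT => ne.
  have : [set` s] p by rewrite -hs.
  move=> /= ps; move: Bp; rewrite leqNgt ltnS => /negP[].
  exact: (bigmaxn_sup_seq p).
pose pi : nat_pred := [pred p | (p < B)%N].
have dvd n : ((n`! ^ 2)`_(pi^') %| `|euler_form xi a b n|)%N.
  by apply: part_fact_dvd_euler_form => // p pp; rewrite !inE -leqNgt; exact: E.
(* A nonzero form would give [n!^2 <= (B!^n)^2 * K n! (3|xi|)^n], the first factor bounding the part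
   of [n!^2] at primes below [B]. Cancelling [n!] leaves [n! <= K * C ^ n], false for [n >= n0]. *)
pose K := (`|a| + `|b|)%N; pose C := (B`! ^ 2 * (3 * `|xi|))%N.
have [n0 hn] := expn_ltn_fact C K.
have form0 n : (n0 <= n)%N -> euler_form xi a b n = 0.
  move=> n0n; have := hn n n0n; apply: contraTeq => nz; rewrite -leqNgt.
  have f0 := fact_gt0 n.
  rewrite -(@leq_pmul2l n`! n`! (K * C ^ n)) ?f0 // mulnn.
  rewrite -[leqLHS](partnC pi) ?expn_gt0 ?f0 //.
  have le2 : (`|euler_form xi a b n| <= K * n`! * (3 * `|xi|) ^ n)%N.
    have := euler_form_bound xi a b n hxi.
    rewrite -lez_nat => /le_trans; apply.
    by rewrite -[leRHS]natz !(natrM, natrX, natrD) !natz !abszE.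
  apply: (@leq_trans ((B`! ^ n) ^ 2 * (K * n`! * (3 * `|xi|) ^ n))).
    apply: leq_mul; first by rewrite partnX leq_sqr part_fact_leq.
    by apply: leq_trans (dvdn_leq _ (dvd n)) le2; rewrite absz_gt0.
  rewrite expnAC [(C ^ n)%N]expnMn; apply: eq_leq; ring.
by have := euler_form_neq0 xi a b n0 hxi hb; rewrite !form0.
Qed.
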